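(* Let $k\ge 3$. Then $\displaystyle\lim_{n\to\infty}\frac{M_k(n)-L_k(n)}{L_k(n)}=0$, where $L_k(n)=|\mathbf{S}_k(n)|$.
   Context: Let $\Sigma=\{0,1,\dots,k-1\}$. Strings are compared lexicographically ($\alpha<\beta$ if $\alpha$ is a proper prefix of $\beta$, or $\alpha$ has the smaller symbol at the first index where they differ). For $\alpha=a_1\cdots a_n$, $\alpha^R=a_n\cdots a_1$; $[\alpha]$ is the set of rotations of $\alpha$. $\alpha$ is a necklace if it is the lexicographically smallest element of $[\alpha]$; a bracelet if it is the lexicographically smallest element of $[\alpha]\cup[\alpha^R]$. A necklace $\alpha$ is symmetric if $\alpha^R\in[\alpha]$, asymmetric otherwise. $\mathbf{A}_k(n)$ is the set of asymmetric bracelets of length $n$ over $\Sigma$, and $\mathbf{S}_k(n)=\bigcup_{\alpha\in\mathbf{A}_k(n)}[\alpha]$. A cyclic sequence $s_1\cdots s_L$ has windows $w_t=s_t\cdots s_{t+n-1}$ ($t=1,\dots,L$, indices mod $L$); it is an orientable sequence of order $n$ if the $2L$ strings $w_1,\dots,w_L,w_1^R,\dots,w_L^R$ are pairwise distinct. $M_k(n)$ is the maximum length of an orientable sequence of order $n$ over $\Sigma$. *)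

(* Defs.v *)
From mathcomp Require Import all_boot.
Set Implicit Arguments. Unset Strict Implicit. Unset Printing Implicit Defensive.

(* Strings over Sigma = {0,...,k-1} are represented as seq nat (alphabet
   membership is enforced where strings are quantified, via tuples over 'I_k). *)

Fixpoint lex_lt (a b : seq nat) : bool :=
  match a, b with
  | [::], [::] => false
  | [::], _ :: _ => true
  | _ :: _, [::] => false
  | x :: a', y :: b' => (x < y) || ((x == y) && lex_lt a' b')
  end.

Definition lex_le (a b : seq nat) : bool := (a == b) || lex_lt a b.

Definition rots (a : seq nat) : seq (seq nat) :=
  [seq rot i a | i <- iota 0 (size a).+1].

Definition necklace (a : seq nat) : bool := all (lex_le a) (rots a).

Definition bracelet (a : seq nat) : bool :=
  all (lex_le a) (rots a ++ rots (rev a)).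

Definition symmetric_necklace (a : seq nat) : bool :=
  necklace a && (rev a \in rots a).

Definition asym_bracelet (a : seq nat) : bool :=
  bracelet a && necklace a && (rev a \notin rots a).

Definition in_S (k n : nat) (b : seq nat) : bool :=
  [exists a : n.-tuple 'I_k,
     asym_bracelet (map val a) && (b \in rots (map val a))].

Definition Lk (k n : nat) : nat :=
  #|[set t : n.-tuple 'I_k | in_S k n (map val t)]|.

Definition window (s : seq nat) (n t : nat) : seq nat :=
  [seq nth 0 s ((t + j) %% size s) | j <- iota 0 n].

Definition orientable (s : seq nat) (n : nat) : bool :=
  let W := [seq window s n t | t <- iota 0 (size s)] in
  uniq (W ++ map rev W).

(* M_k(n): maximum length of an orientable sequence of order n over Sigma.
   Any orientable sequence has 2L <= k^n (distinct windows), so ranging over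
   L <= k^n loses nothing; L = 0 (empty sequence) makes the range nonempty. *)
Definition Mk (k n : nat) : nat :=
  \max_(L < (k ^ n).+1 | [exists s : L.-tuple 'I_k, orientable (map val s) n]) L.

(* Main.v *)
From mathcomp Require Import all_boot all_order all_algebra all_fingroup zify.
Require Import Defs.

Set Implicit Arguments.
Unset Strict Implicit.
Unset Printing Implicit Defensive.

Import Order.TTheory GRing.Theory Num.Theory.

(** The chirality of a word is the number of cyclic factors 01 minus the number
    of cyclic factors 10; it is invariant under rotation and changes sign under
    reversal.  Hence the set of right-handed words, those of positive chirality,
    is closed under rotation and disjoint from its reversal.  Overwriting letters
    by 2 connects every right-handed word, through right-handed words, to
    [0 1 2 ... 2], so joining the cycles of the pure rotation gives an orientable
    sequence whose windows are exactly the right-handed words.  A symmetric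
    necklace has chirality 0.  Therefore, with Z the number of words of chirality
    0, both [2 * Mk k n] and [2 * Lk k n] lie between [k ^ n - Z] and [k ^ n].
    Finally Z is [o(k ^ n)]: almost every word contains, at an aligned position,
    one of the J blocks [(012)^j 0^(3(J-j))] with [j < J], and exchanging the
    first such block for another one changes the chirality. *)

(** * Chirality *)

Definition turn (x y : nat) : int :=
  ((x == 0) && (y == 1))%:Z - ((x == 1) && (y == 0))%:Z.

Fixpoint path_turn (x : nat) (s : seq nat) : int :=
  if s is y :: s' then (turn x y + path_turn y s')%R else 0%R.

Definition chirality (w : seq nat) : int :=
  if w is x :: s then path_turn x (rcons s x) else 0%R.

Definition right_handed w := (0 < chirality w)%R.

Lemma turnC x y : turn y x = (- turn x y)%R.
Proof. by rewrite /turn andbC [(y == 1) && _]andbC opprB. Qed.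

Lemma turn2l x : turn 2 x = 0%R.
Proof. by rewrite /turn /= subrr. Qed.

Lemma turn2r x : turn x 2 = 0%R.
Proof. by rewrite turnC turn2l oppr0. Qed.

Lemma path_turn_cat x s t :
  path_turn x (s ++ t) = (path_turn x s + path_turn (last x s) t)%R.
Proof. by elim: s x => [|y s IH] x /=; rewrite ?add0r // IH addrA. Qed.

Lemma path_turn_rcons x s y :
  path_turn x (rcons s y) = (path_turn x s + turn (last x s) y)%R.
Proof. by rewrite -cats1 path_turn_cat /= addr0. Qed.

Lemma path_turn_rev x s :
  path_turn (last x s) (rev (belast x s)) = (- path_turn x s)%R.
Proof.
elim: s x => [|y s IH] x /=; first by rewrite oppr0.
rewrite rev_cons path_turn_rcons IH opprD addrC turnC; congr (- turn _ _ + _)%R.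
by case: s {IH} => //= z s; rewrite rev_cons last_rcons.
Qed.

Lemma chirality_rot i w : chirality (rot i w) = chirality w.
Proof.
rewrite /rot -[in RHS](cat_take_drop i w).
case: (take i w) => [|x s]; first by rewrite cats0.
case: (drop i w) => [|y t]; first by rewrite cats0.
rewrite /= !rcons_cat /= !path_turn_cat /= !path_turn_rcons.
by lia.
Qed.

Lemma chirality_rev w : chirality (rev w) = (- chirality w)%R.
Proof.
case: w => [|x s]; first by rewrite /= oppr0.
rewrite rev_cons -cats1 -(chirality_rot (size (rev s))) rot_size_cat /=.
have := path_turn_rev x (rcons s x).
by rewrite last_rcons belast_rcons rev_cons.
Qed.

Lemma path_turnE x s :
  path_turn x s = (\sum_(i < size s) turn (nth 0%N (x :: s) i) (nth 0%N s i))%R.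
Proof.
elim: s x => [|y s IH] x /=; first by rewrite big_ord0.
by rewrite big_ord_recl /= IH.
Qed.

Lemma nth_rot0 (w : seq nat) i : i < size w -> nth 0 (rot i w) 0 = nth 0 w i.
Proof.
by move=> lt_i; rewrite /rot nth_cat size_drop subn_gt0 lt_i nth_drop addn0.
Qed.

(** Reading each cyclic factor as the first two letters of a rotation avoids index arithmetic modulo
    the length. On a one-letter word [nth] would return its default 0 instead of wrapping round. *)
Lemma chirality_sum w : 1 < size w ->
  chirality w =
    (\sum_(i < size w) turn (nth 0%N (rot i w) 0) (nth 0%N (rot i w) 1))%R.
Proof.
case: w => [|x [|y s]] // _; rewrite /chirality path_turnE size_rcons.
apply: eq_bigr => i _; rewrite nth_rot0 // -rcons_cons.
have := ltn_ord i; rewrite [X in _ < X]/= => lt_i; congr turn.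
  by rewrite nth_rcons /= lt_i.
rewrite /rot nth_cat size_drop nth_drop addn1 nth_rcons.
have [lt_is|ge_is] := ltnP i (size (y :: s)).
  by rewrite ltn_subRL addn1 ltnS lt_is.
have -> : (i : nat) = size (y :: s) by move: lt_i ge_is => /=; lia.
by rewrite eqxx subSnn ltnn.
Qed.

(** Only the two cyclic factors through the head change, and a factor containing 2 has turn 0. *)
Lemma chirality_set_head2 x u : 0 < size u ->
  chirality (2 :: u) =
    (chirality (x :: u) - (turn (last x u) x + turn x (nth 0%N u 0)))%R.
Proof.
case: u => // y u _.
by rewrite /= !path_turn_rcons turn2l turn2r; lia.
Qed.

Lemma sum_head_rot (P : pred nat) w :
  \sum_(i < size w) P (nth 0 (rot i w) 0) = count P w.
Proof.
rewrite -sum1_count (big_nth 0) big_mkord [in RHS]big_mkcond /=.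
by apply: eq_bigr => i _; rewrite nth_rot0 //; case: (P _).
Qed.

(* The losses caused by overwriting one letter of [w] with 2 sum to
   [2 * chirality w] over all letters, and a letter 2 loses nothing: when at
   least three letters differ from 2, one of the losses is below the average
   and hence less than [chirality w]. *)
Lemma overwritable_letter w : right_handed w -> 2 < count (predC1 2) w ->
  exists i x u, [/\ i < size w, rot i w = x :: u, x != 2
                  & right_handed (2 :: u)].
Proof.
rewrite {1}/right_handed => c_gt0 cnt_gt2.
have n_gt2 : 2 < size w by apply: leq_trans cnt_gt2 (count_size _ _).
set F := fun v => turn (nth 0 v 0) (nth 0 v 1).
have sumF v : 1 < size v -> chirality v = (\sum_(i < size v) F (rot i v))%R.
  exact: chirality_sum.
(* Shifting the sum by one letter makes its term at [i] the turn into that letter, while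
   [F (rot i w)] is the turn out of it. *)
have sumFS : chirality w = (\sum_(i < size w) F (rot i (rotr 1 w)))%R.
  rewrite -[in LHS](rotrK 1 w) chirality_rot sumF ?size_rotr //.
  exact: ltnW.
have [/existsP[i /andP[hd_i good_i]]|no_i] := boolP [exists i : 'I_(size w),
   (nth 0 (rot i w) 0 != 2) &&
   (F (rot i w) + F (rot i (rotr 1 w)) < chirality w)%R].
  case def_u: (rot i w) hd_i good_i => [|x u] hd_i good_i.
    by have := size_rot i w; rewrite def_u => /= w0; move: n_gt2; rewrite -w0.
  exists i, x, u; split=> //.
  have sz_u : (size u).+1 = size w by rewrite -(size_rot i w) def_u.
  rewrite /right_handed (@chirality_set_head2 x); last by lia.
  rewrite -def_u chirality_rot.
  have -> : turn (last x u) x = F (rot i (rotr 1 w)); last first.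
    by move: good_i; rewrite {1}/F /=; lia.
  rewrite rot_rotr def_u /F.
  case/lastP: u {def_u good_i hd_i} sz_u => [|u y]; first by move=> /= ?; lia.
  by rewrite -rcons_cons rotr1_rcons last_rcons.
(* If every letter other than 2 lost at least [chirality w], comparing totals would leave at most
   two such letters. *)
suff: (chirality w * (count (predC1 2%N) w)%:Z <= chirality w + chirality w)%R.
  by rewrite -mulr2n -mulr_natr ler_pM2l //; lia.
rewrite {2}sumF ?[X in (_ <= _ + X)%R]sumFS; last exact: ltnW.
rewrite -big_split /= -sum_head_rot -natz natr_sum mulr_sumr.
apply: ler_sum => i _ /=.
move/existsPn/(_ i): no_i; rewrite negb_and negbK -leNgt.
have [hd2 _|_ /=] := eqVneq (nth 0 (rot i w) 0) 2; last by rewrite mulr1.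
rewrite mulr0 /F hd2 turn2l add0r rot_rotr.
case/lastP def_u: (rot i w) => [|u y].
  by have := size_rot i w; rewrite def_u => /= w0; move: n_gt2; rewrite -w0.
move: hd2; rewrite def_u rotr1_rcons; case: u {def_u} => [/= ->|z u /= ->].
  by rewrite turn2l.
by rewrite turn2r.
Qed.

Lemma right_handed_rot i w : right_handed (rot i w) = right_handed w.
Proof. by rewrite /right_handed chirality_rot. Qed.

Lemma right_handed01 w : right_handed w -> 1 < size w ->
  exists i u, i < size w /\ rot i w = [:: 0, 1 & u].
Proof.
rewrite /right_handed => c_gt0 w_gt1; move: c_gt0; rewrite chirality_sum //.
have [/existsP[i /andP[/eqP hd0 /eqP hd1]] _|no_i] := boolP [exists i : 'I_(size w),
    (nth 0 (rot i w) 0 == 0) && (nth 0 (rot i w) 1 == 1)].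
  exists i; case: (rot i w) (size_rot i w) hd0 hd1 => [|x [|y u]] /= sz_w; try lia.
  by move=> -> ->; exists u.
rewrite ltNge sumr_le0 // => i _; move/existsPn/(_ i): no_i.
by rewrite /turn => /negbTE ->; rewrite sub0r oppr_le0.
Qed.

(** * Connectivity of the right-handed words *)

Section Connectivity.

Variables (k n : nat) (Q : pred (seq nat)).

Definition word (w : seq nat) := (size w == n) && all (gtn k) w.

Lemma word_rot i w : word (rot i w) = word w.
Proof.
by rewrite /word size_rot; congr (_ && _); apply/eq_all_r => x; rewrite mem_rot.
Qed.

Hypothesis k_gt2 : 2 < k.
Hypothesis Q_rot : forall w, word w -> right_handed w -> Q (rot 1 w) = Q w.
Hypothesis Q_head : forall x y u,
  word (x :: u) -> right_handed (x :: u) ->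
  word (y :: u) -> right_handed (y :: u) -> Q (x :: u) = Q (y :: u).

Lemma Q_rotn i w : word w -> right_handed w -> i <= size w -> Q (rot i w) = Q w.
Proof.
move=> w_w rw; elim: i => [|i IH] lt_i; first by rewrite rot0.
by rewrite rotS // Q_rot ?word_rot ?right_handed_rot // IH // ltnW.
Qed.

(** Connectivity is expressed through an arbitrary [Q] that rotations and head changes preserve. The
    induction is on the number of letters other than 2; once at most two remain, the factor 01
    accounts for both, and the word is a rotation of the target. *)
Lemma right_handed_connected w : 1 < n -> word w -> right_handed w ->
  Q w = Q [:: 0, 1 & nseq n.-2 2].
Proof.
move=> n_gt1.
have [m] := ubnP (count (predC1 2) w); elim: m w => // m IH w lt_m w_w rw.
have sz_w : size w = n by case/andP: w_w => /eqP.
have [cnt_gt2|cnt_le2] := ltnP 2 (count (predC1 2) w).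
  have [i [x [u [lt_i def_u x2 r2u]]]] := overwritable_letter rw cnt_gt2.
  have w_xu : word (x :: u) by rewrite -def_u word_rot.
  have r_xu : right_handed (x :: u) by rewrite -def_u right_handed_rot.
  have w_2u : word (2 :: u) by move: w_xu; rewrite /word /= k_gt2 => /and3P[-> _ ->].
  rewrite -(Q_rotn w_w rw (ltnW lt_i)) def_u (Q_head w_xu r_xu w_2u r2u) IH //.
  have : count (predC1 2) (x :: u) = count (predC1 2) w.
    by rewrite -def_u; apply/seq.permP; rewrite perm_rot.
  by rewrite /= x2 => cnt_w; move: lt_m; rewrite -cnt_w.
have [|i [u [lt_i def_u]]] := right_handed01 rw; first by rewrite sz_w.
rewrite -(Q_rotn w_w rw (ltnW lt_i)) def_u.
have : count (predC1 2) [:: 0, 1 & u] = count (predC1 2) w.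
  by rewrite -def_u; apply/seq.permP; rewrite perm_rot.
move=> /= cnt_u; have /all_pred1P : all (pred1 2) u.
  rewrite -[all _ _]negbK -has_predC has_count.
  by move: cnt_le2; rewrite -cnt_u; case: (count _ u).
have : size [:: 0, 1 & u] = n by rewrite -def_u size_rot.
by move=> /= <- ->; rewrite size_nseq.
Qed.

End Connectivity.

(** * Cycle joining *)

Section CycleJoining.

Variables (A : finType) (n : nat).
Local Notation T := (n.+1.-tuple A).
Variable E : {set T}.
Hypothesis E_rot : forall t : T, (rot_tuple 1 t \in E) = (t \in E).

(** These are the nonsingular feedback shift registers that preserve [E]: a step drops the first
    letter and appends an arbitrary one. *)
Definition shift_stable (s : {perm T}) :=
  [forall t : T, (take n (s t) == behead t :> seq A) && ((s t \in E) == (t \in E))].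

Lemma shift_stableP (s : {perm T}) :
  reflect (forall t : T, take n (s t) = behead t /\ (s t \in E) = (t \in E))
          (shift_stable s).
Proof.
apply: (iffP forallP) => [s_ok t | s_ok t].
  by have /andP[/eqP -> /eqP ->] := s_ok t.
by have [-> ->] := s_ok t; rewrite !eqxx.
Qed.

Lemma rot1_tuple_inj : injective (fun t : T => rot_tuple 1 t : T).
Proof. by move=> t u /(congr1 val) /= /rot_inj /val_inj. Qed.

Lemma take_rot1 (t : T) : take n (rot 1 t) = behead t.
Proof.
case/tupleP: t => x t; rewrite /= rot1_cons -cats1 take_size_cat //.
exact: size_tuple.
Qed.

Lemma rot_shift_stable : shift_stable (perm rot1_tuple_inj).
Proof. by apply/shift_stableP => t; rewrite permE take_rot1 E_rot. Qed.

(** Minimality of the number of orbits replaces an explicit sequence of cycle joins; the pure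
    rotation shows that there are candidates. *)
Definition joined : {perm T} :=
  [arg min_(s < perm rot1_tuple_inj | shift_stable s) #|porbits s|].

Lemma joined_shift_stable : shift_stable joined.
Proof. by rewrite /joined; case: arg_minnP => //; exact: rot_shift_stable. Qed.

(* Otherwise composing with the transposition of [t] and [u] would merge their
   two orbits. *)
Lemma joined_porbit (t u : T) : t \in E -> u \in E ->
  behead t = behead u :> seq A -> t \in porbit joined u.
Proof.
rewrite /joined; case: arg_minnP => [|s s_ok s_min Et Eu eq_tu].
  exact: rot_shift_stable.
apply: contraT => out_tu.
have ne_tu : t != u by apply: contraNneq out_tu => ->; exact: porbit_id.
(* Swapping two words of [E] with equal tails before applying [s] affects neither the tail passed on
   nor membership in [E]. *)
have ts_ok : shift_stable (tperm t u * s)%g.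
  move/shift_stableP: s_ok => s_ok; apply/shift_stableP => v.
  have [sv Ev] := s_ok (tperm t u v); rewrite permM sv Ev.
  by case: tpermP => [->|->|] //; rewrite ?eq_tu ?Et ?Eu.
have := porbits_mul_tperm s t u; have := s_min _ ts_ok.
by rewrite /= out_tu ne_tu; lia.
Qed.

(** The predecessor of [rot_tuple 1 t] under [joined] lies in [E] and has the same tail as [t], so
    [joined_porbit] puts it on the orbit of [t]. *)
Lemma joined_rot (t : T) : t \in E -> rot_tuple 1 t \in porbit joined t.
Proof.
move=> Et; have /shift_stableP j_ok := joined_shift_stable.
have [take_z Ez] := j_ok ((joined^-1)%g (rot_tuple 1 t)).
move: take_z Ez; rewrite permKV take_rot1 E_rot Et => take_z Ez.
have := joined_porbit (esym Ez) Et (esym take_z).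
rewrite -!eq_porbit_mem => /eqP <-.
by rewrite eq_porbit_mem -{1}(permKV joined (rot_tuple 1 t)) (mem_porbit joined 1).
Qed.

Lemma joined_iter_in (t : T) i : (iter i joined t \in E) = (t \in E).
Proof.
have /shift_stableP j_ok := joined_shift_stable.
by elim: i => //= i <-; have [] := j_ok (iter i joined t).
Qed.

(** Each step shifts the word by one letter. Hence the heads along an orbit spell a sequence whose
    windows are the words of that orbit. *)
Lemma nth_joined (x0 : A) (t : T) j : j <= n ->
  nth x0 t j = thead (iter j joined t).
Proof.
have /shift_stableP j_ok := joined_shift_stable.
elim: j t => [|j IH] t le_jn; first by case/tupleP: t.
rewrite iterSr -IH; last exact: ltnW.
by have [take_t _] := j_ok t; rewrite -(nth_take x0 le_jn) take_t nth_behead.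
Qed.

End CycleJoining.

Lemma iter_period (S : Type) (f : S -> S) x L i :
  iter L f x = x -> iter (i %% L) f x = iter i f x.
Proof.
move=> fL; rewrite {2}(divn_eq i L) addnC iterD; congr iter.
by elim: (i %/ L) => //= q IH; rewrite mulSn iterD -IH fL.
Qed.

(** * Words as tuples, and an orientable sequence through all right-handed words *)

Definition str k n (t : n.-tuple 'I_k) : seq nat := map val t.

Lemma str_inj k n : injective (@str k n).
Proof. by move=> t u /(inj_map val_inj) /val_inj. Qed.

Lemma word_str k n (t : n.-tuple 'I_k) : word k n (str t).
Proof.
by rewrite /word size_map size_tuple eqxx; apply/allP=> _ /mapP[x _ ->] /=.
Qed.

Lemma wordP k n w : word k n w -> exists t : n.-tuple 'I_k, w = str t.
Proof.
case/andP=> sz_w /allP w_k.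
have sz : size (pmap (@insub nat (fun x => x < k) 'I_k) w) == n.
  rewrite size_pmap_sub -(eqP sz_w) -all_count.
  by apply/allP => x /w_k.
exists (Tuple sz); rewrite /str /=.
rewrite pmap_filter; last exact: insubK.
by symmetry; apply/all_filterP/allP => x /w_k /= lt_xk; rewrite insubT.
Qed.

Definition right_words k n := [set t : n.-tuple 'I_k | right_handed (str t)].

Section RightSequence.

Variables k n : nat.
Hypothesis k_gt2 : 2 < k.
Local Notation T := (n.+1.-tuple 'I_k).
Local Notation E := (right_words k n.+1).

Lemma right_words_rot (t : T) : (rot_tuple 1 t \in E) = (t \in E).
Proof. by rewrite !inE /str /= map_rot right_handed_rot. Qed.

Let sigma := joined E.

(** Connectivity is applied to the predicate of lying on the orbit of [t]: [joined_rot] makes it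
    invariant under rotation, [joined_porbit] under a change of head. *)
Lemma right_words_porbit t u : t \in E -> u \in E -> u \in porbit sigma t.
Proof.
move=> Et Eu.
(* A one-letter word has chirality 0, so the length [n.+1] is at least 2. *)
have n_gt0 : 0 < n.
  move: Et; rewrite inE /str; case: n t => // /tupleP[x t] /=.
  by rewrite tuple0 /right_handed /= /turn; case: x => [[|[]]].
pose Q w := [exists v : T, (str v == w) && (v \in porbit sigma t)].
have Qstr v : Q (str v) = (v \in porbit sigma t).
  apply/existsP/idP => [[v' /andP[/eqP /str_inj -> //]]|tv].
  by exists v; rewrite eqxx.
have Qrot w : word k n.+1 w -> right_handed w -> Q (rot 1 w) = Q w.
  case/wordP=> v -> rv.
  have -> : rot 1 (str v) = str (rot_tuple 1 v) by rewrite /str /= map_rot.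
  have Ev : v \in E by rewrite inE.
  have := joined_rot right_words_rot Ev; rewrite -eq_porbit_mem => /eqP eq_v.
  by rewrite !Qstr porbit_sym eq_v porbit_sym.
have Qhead x y s : word k n.+1 (x :: s) -> right_handed (x :: s) ->
    word k n.+1 (y :: s) -> right_handed (y :: s) -> Q (x :: s) = Q (y :: s).
  move=> /wordP[v def_v] + /wordP[v' def_v']; rewrite def_v def_v' => rv rv'.
  have eq_v : behead v = behead v' :> seq 'I_k.
    apply: (inj_map val_inj); rewrite -!behead_map.
    by rewrite -/(str _) -def_v -/(str _) -def_v'.
  have := joined_porbit right_words_rot _ _ eq_v; rewrite !inE => /(_ rv rv').
  rewrite -eq_porbit_mem => /eqP eq_vv'.
  by rewrite !Qstr porbit_sym eq_vv' porbit_sym.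
have Qconn v : v \in E -> Q (str v) = Q [:: 0, 1 & nseq n.+1.-2 2].
  rewrite inE => rv; apply: (right_handed_connected k_gt2 Qrot Qhead) => //.
  exact: word_str.
by rewrite -Qstr Qconn // -(Qconn t) // Qstr porbit_id.
Qed.

Lemma right_words_leq_Mk_S : #|E| <= Mk k n.+1.
Proof.
have [->|[t Et]] := set_0Vmem E; first by rewrite cards0.
have def_E : E = porbit sigma t.
  apply/setP => u; apply/idP/idP; first exact: right_words_porbit.
  by case/porbitP=> i ->; rewrite permX joined_iter_in //; exact: right_words_rot.
have x0 : 'I_k by exact: Ordinal k_gt2.
set L := #|E|.
have lt_L : L < (k ^ n.+1).+1.
  by rewrite ltnS -[k in k ^ _]card_ord -card_tuple max_card.
have iterL : iter L sigma t = t by rewrite /L def_E iter_porbit.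
apply: (@leq_bigmax_cond _ _ (fun L : 'I_(k ^ n.+1).+1 => L : nat) (Ordinal lt_L)).
pose s : L.-tuple 'I_k := [tuple thead (iter i sigma t) | i < L].
apply/existsP; exists s; rewrite /orientable.
have sz_s : size (map val s) = L by rewrite size_map size_tuple.
have L_gt0 : 0 < L by apply/card_gt0P; exists t.
(* Letter [i + j] of the sequence is the head of iterate [i + j], which is letter [j] of iterate
   [i]; the index may wrap because the orbit has period [L]. *)
have win i : i < L -> window (map val s) n.+1 i = str (iter i sigma t).
  move=> lt_i; apply: (@eq_from_nth _ 0).
    by rewrite !size_map size_iota size_tuple.
  rewrite size_map size_iota => j lt_j.
  rewrite (nth_map 0) ?size_iota // nth_iota // sz_s add0n.
  have lt_ij : (i + j) %% L < L by rewrite ltn_mod.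
  rewrite (nth_map x0) ?size_tuple // (nth_map x0) ?size_tuple //.
  rewrite -(tnth_nth x0 s (Ordinal lt_ij)) tnth_mktuple /= iter_period //.
  by rewrite (nth_joined right_words_rot) // addnC iterD.
have -> : [seq window (map val s) n.+1 i | i <- iota 0 (size (map val s))] =
          map (@str k n.+1) (traject sigma t L).
  apply: (@eq_from_nth _ [::]); rewrite sz_s.
    by rewrite !size_map size_iota size_traject.
  rewrite size_map size_iota => i lt_i.
  rewrite (nth_map 0) ?size_iota // nth_iota // add0n win //.
  by rewrite (nth_map t) ?size_traject // nth_traject.
have uniqW : uniq (map (@str k n.+1) (traject sigma t L)).
  by rewrite (map_inj_uniq (@str_inj _ _)) /L def_E uniq_traject_porbit.
rewrite cat_uniq uniqW (map_inj_uniq (can_inj revK)) uniqW andbT /=.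
have rW w : w \in map (@str k n.+1) (traject sigma t L) -> right_handed w.
  case/mapP=> v /trajectP[i _ ->] ->.
  have : iter i sigma t \in E by rewrite (joined_iter_in right_words_rot).
  by rewrite inE.
(* Reversal negates chirality, so no reversed window is itself a window. *)
apply/hasPn => _ /mapP[w /rW rw ->]; apply/negP => /rW; move: rw.
by rewrite /right_handed chirality_rev; lia.
Qed.

End RightSequence.

Lemma right_words_leq_Mk k n : 2 < k -> #|right_words k n| <= Mk k n.
Proof.
case: n => [|n] k_gt2; last exact: right_words_leq_Mk_S.
have -> : right_words k 0 = set0; last by rewrite cards0.
by apply/setP => t; rewrite !inE tuple0.
Qed.

(** * Bracelets *)

Lemma lex_lt_irr a : lex_lt a a = false.
Proof. by elim: a => //= x a ->; rewrite ltnn eqxx. Qed.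

Lemma lex_lt_trans : transitive lex_lt.
Proof.
elim=> [|y b IH] [|x a] [|z c] //=.
case/orP=> [lt_xy|/andP[/eqP -> lt_ab]]; case/orP=> [lt_yz|/andP[/eqP <- lt_bc]].
- by rewrite (ltn_trans lt_xy).
- by rewrite lt_xy.
- by rewrite lt_yz.
- by rewrite eqxx (IH _ _ lt_ab lt_bc) orbT.
Qed.

Lemma lex_le_trans : transitive lex_le.
Proof.
move=> b a c /orP[/eqP -> //|lt_ab] /orP[/eqP <-|lt_bc].
  by rewrite /lex_le lt_ab orbT.
by rewrite /lex_le (lex_lt_trans lt_ab lt_bc) orbT.
Qed.

Lemma lex_le_anti : antisymmetric lex_le.
Proof.
move=> a b /andP[/orP[/eqP //|lt_ab] /orP[/eqP //|lt_ba]].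
by have := lex_lt_trans lt_ab lt_ba; rewrite lex_lt_irr.
Qed.

Lemma lex_le_total : total lex_le.
Proof.
rewrite /lex_le; elim=> [|x a IH] [|y b] //=; rewrite !eqseq_cons.
by case: (ltngtP x y) (IH b) => // -> /=; rewrite eqxx.
Qed.

Lemma lex_min_exists (s : seq (seq nat)) : 0 < size s ->
  exists2 a, a \in s & all (lex_le a) s.
Proof.
elim: s => // x [|y s] IH _.
  by exists x; rewrite ?mem_head //= /lex_le eqxx.
have [//|a a_in a_min] := IH.
have [le_xa|le_ax] := orP (lex_le_total x a).
  exists x; rewrite ?mem_head // [all _ _]/= {1}/lex_le eqxx /=.
  by apply: sub_all a_min => b; exact: lex_le_trans.
by exists a; [rewrite in_cons a_in orbT | apply/andP].
Qed.

Lemma rotsP a b : reflect (exists i, b = rot i a) (b \in rots a).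
Proof.
apply: (iffP mapP) => [[i _ ->]|[i ->]]; first by exists i.
have [le_i|gt_i] := leqP i (size a).
  by exists i; rewrite // mem_iota.
by exists 0; rewrite // rot0 rot_oversize // ltnW.
Qed.

Lemma rots_sym a b : (b \in rots a) = (a \in rots b).
Proof.
have aux c d : d \in rots c -> c \in rots d.
  case/rotsP=> i ->; apply/rotsP; exists (size (rot i c) - i).
  by rewrite -/(rotr i _) rotK.
by apply/idP/idP; exact: aux.
Qed.

Lemma rots_trans b a c : b \in rots a -> c \in rots b -> c \in rots a.
Proof.
move=> /rotsP[i ->] /rotsP[j ->]; rewrite rot_rot_add.
by apply/rotsP; eexists.
Qed.

Lemma rots_rev a b : (rev b \in rots (rev a)) = (b \in rots a).
Proof.
have aux c d : d \in rots c -> rev d \in rots (rev c).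
  case/rotsP=> i ->; rewrite rev_rot; apply/rotsP.
  by exists (size (rev c) - i).
by apply/idP/idP => [/aux|/aux //]; rewrite !revK.
Qed.

Lemma chirality_rots a b : b \in rots a -> chirality b = chirality a.
Proof. by case/rotsP=> i ->; rewrite chirality_rot. Qed.

Lemma symmetric_achiral a : rev a \in rots a -> chirality a = 0%R.
Proof. by move/chirality_rots; rewrite chirality_rev; lia. Qed.

(** The lexicographic minimum over the rotations of [w] and [rev w] is a bracelet; were it
    symmetric, its chirality, and so that of [w], would vanish. *)
Lemma chiral_bracelet w : chirality w != 0%R -> exists2 a, asym_bracelet a &
  (w \in rots a) || (rev w \in rots a).
Proof.
move=> cw; have [|a] := @lex_min_exists (rots w ++ rots (rev w)).
  by rewrite size_cat size_map size_iota.
rewrite mem_cat => a_in a_min.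
have brac : bracelet a.
  apply/allP => b; rewrite mem_cat => b_in; apply: (allP a_min); rewrite mem_cat.
  case/orP: a_in => a_in; case/orP: b_in => b_in.
  - by rewrite (rots_trans a_in b_in).
  - by rewrite orbC (rots_trans _ b_in) ?rots_rev.
  - by rewrite orbC (rots_trans a_in b_in).
  - by rewrite (rots_trans _ b_in) // -rots_rev revK.
exists a.
  rewrite /asym_bracelet brac /=; apply/andP; split.
    by move: brac; rewrite /bracelet all_cat => /andP[].
  apply: contra cw => /symmetric_achiral; case/orP: a_in => /chirality_rots ->.
    by move->.
  by rewrite chirality_rev => /eqP; rewrite oppr_eq0.
by rewrite ![_ \in rots a]rots_sym.
Qed.

Lemma bracelet_le a b : bracelet a -> (b \in rots a) || (rev b \in rots a) ->
  lex_le a b.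
Proof.
move=> /allP a_min b_in; apply: a_min; rewrite mem_cat.
by rewrite -[b \in rots (rev a)]rots_rev revK.
Qed.

(** Otherwise [a] and [b] would be bracelets of one class under rotation and reversal, hence equal,
    and [rev a] would be a rotation of [a]. This makes the words counted by [Lk] disjoint from their
    reversals. *)
Lemma asym_bracelet_chiral a b w : asym_bracelet a -> asym_bracelet b ->
  w \in rots a -> rev w \notin rots b.
Proof.
move=> /andP[/andP[ba _] asym] /andP[/andP[bb _] _] wa; apply: contra asym => wb.
have ra : rev a \in rots b.
  by rewrite (rots_trans wb) // rots_rev rots_sym.
suff eq_ab : a = b by rewrite [X in rots X]eq_ab.
apply: lex_le_anti; rewrite !bracelet_le ?ra ?orbT //.
by rewrite -[rev b \in _]rots_rev revK [_ \in rots (rev a)]rots_sym ra orbT.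
Qed.

(** * Counting by pairing each word with its reversal *)

Section Counting.

Variables k n : nat.
Local Notation T := (n.-tuple 'I_k).

Definition achiral_words := [set t : T | chirality (str t) == 0%R].
Definition S_words := [set t : T | in_S k n (str t)].

Lemma str_rev (t : T) : str (rev_tuple t) = rev (str t).
Proof. by rewrite /str /= map_rev. Qed.

Lemma rev_tuple_inj : injective (fun t : T => rev_tuple t : T).
Proof. by move=> t u /(congr1 val) /= /(can_inj revK) /val_inj. Qed.

Lemma card_words : #|{: T}| = k ^ n.
Proof. by rewrite card_tuple card_ord. Qed.

Lemma card_rev_disjoint (X : {set T}) :
  (forall t : T, t \in X -> rev_tuple t \notin X) -> (#|X|).*2 <= k ^ n.
Proof.
move=> dis; rewrite -card_words -addnn -{2}(card_imset (mem X) rev_tuple_inj).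
rewrite -cardsUI (_ : _ :&: _ = set0) ?cards0 ?addn0 ?max_card //.
apply/setP => t; rewrite !inE; apply/negP => /andP[Xt /imsetP[u Xu def_t]].
by move: (dis _ Xu); rewrite -def_t Xt.
Qed.

Lemma card_rev_cover (X : {set T}) :
  (forall t : T, chirality (str t) != 0%R -> (t \in X) || (rev_tuple t \in X)) ->
  k ^ n <= (#|X|).*2 + #|achiral_words|.
Proof.
move=> cov; rewrite -card_words -addnn -{2}(card_imset (mem X) rev_tuple_inj).
rewrite -cardsT; apply: leq_trans (leq_trans (leq_card_setU _ achiral_words)
  (leq_add (leq_card_setU X _) (leqnn _))).
apply/subset_leq_card/subsetP => t _; rewrite !inE orbC.
have [//|/cov /orP[-> //|Xt]] := eqVneq.
apply/orP; right; apply/orP; right; apply/imsetP; exists (rev_tuple t) => //.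
by apply: val_inj; rewrite /= revK.
Qed.

Lemma card_right_words : k ^ n <= (#|right_words k n|).*2 + #|achiral_words|.
Proof.
apply: card_rev_cover => t; rewrite !inE str_rev /right_handed chirality_rev; lia.
Qed.

Lemma Lk_le : (Lk k n).*2 <= k ^ n.
Proof.
apply: (@card_rev_disjoint S_words) => t; rewrite !inE => /existsP[a /andP[ba ta]].
apply/existsPn => b; rewrite str_rev; apply/negP => /andP[bb].
by apply/negP; apply: asym_bracelet_chiral ba bb ta.
Qed.

Lemma Lk_ge : k ^ n <= (Lk k n).*2 + #|achiral_words|.
Proof.
apply: (@card_rev_cover S_words) => t /chiral_bracelet[a ba ta].
have /wordP[u def_a] : word k n a.
  case/orP: ta; rewrite rots_sym => /rotsP[i ->]; rewrite word_rot ?word_str //.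
  by rewrite -str_rev word_str.
rewrite !inE str_rev; case/orP: ta => ta; apply/orP; [left|right];
  by apply/existsP; exists u; rewrite -/(str u) -def_a ba ta.
Qed.

Lemma orientable_le L (s : L.-tuple 'I_k) : orientable (map val s) n ->
  L.*2 <= k ^ n.
Proof.
rewrite /orientable; set W := map _ _ => uW.
have sz_W : size W = L by rewrite !size_map size_iota size_tuple.
rewrite -card_words -(size_codom (@str k n)) -addnn -{2}sz_W -sz_W.
rewrite -{2}(size_map rev W) -size_cat; apply: uniq_leq_size => // w.
have inW v : v \in W -> v \in codom (@str k n).
  case/mapP=> i; rewrite mem_iota size_map size_tuple => /andP[_ lt_i] ->.
  have /wordP[t ->] : word k n (window (map val s) n i); last exact: codom_f.
  rewrite /word size_map size_iota eqxx; apply/allP => _ /mapP[j _ ->] /=.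
  apply: (@all_nthP _ (gtn k) _ 0 _).
  - by apply/allP => _ /mapP[x _ ->] /=.
  - by rewrite size_map size_tuple ltn_mod (leq_ltn_trans _ lt_i).
rewrite mem_cat => /orP[/inW //|/mapP[v /inW /codomP[t ->] ->]].
by rewrite -str_rev codom_f.
Qed.

Lemma Mk_le : (Mk k n).*2 <= k ^ n.
Proof.
rewrite /Mk; elim/big_ind: _ => // [x y|L /existsP[s]]; last exact: orientable_le.
by move=> ? ?; rewrite maxnE; lia.
Qed.

End Counting.

(** * Words of chirality zero *)

(** Bernoulli's inequality for [(1 + J / d) ^ m], with denominators cleared. *)
Lemma expn_add_ge d J m : d ^ m * (d + m * J) <= d * (d + J) ^ m.
Proof.
elim: m => [|m IH]; first by rewrite !expn0 mul0n addn0 mul1n muln1.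
apply: (@leq_trans (d ^ m * (d + m * J) * (d + J))).
  rewrite expnSr -!mulnA leq_mul2l; apply/orP; right; nia.
by rewrite expnSr mulnA leq_mul2r IH orbT.
Qed.

(** For [m] at least [d], the term [m * J] in Bernoulli's inequality already exceeds or equals
    [d * J]. *)
Lemma geometric_decay d J m : 0 < m -> d <= m -> J * d ^ m <= (d + J) ^ m.
Proof.
case: d => [|d] m_gt0 le_dm; first by rewrite exp0n // muln0.
rewrite -(@leq_pmul2l d.+1) //; apply: leq_trans (expn_add_ge _ _ _).
rewrite mulnA mulnC leq_mul2l; apply/orP; right.
by apply: leq_trans (leq_addl _ _); rewrite leq_mul2r le_dm orbT.
Qed.

Lemma count_le1 (P : pred nat) s : uniq s ->
  (forall i j, P i -> P j -> i = j) -> count P s <= 1.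
Proof.
move=> s_uniq P_inj; have [/hasP[i _ Pi]|] := boolP (has P s); last first.
  by rewrite has_count -leqNgt leqn0 => /eqP ->.
rewrite (@eq_count _ P (pred1 i)) ?count_uniq_mem ?leq_b1 // => j /=.
by apply/idP/eqP => [/P_inj /(_ Pi)|->].
Qed.

Section Words.

Variable k : nat.

(** Plain sequences rather than tuples, so that a sum over words splits at a prefix. *)
Fixpoint words n : seq (seq nat) :=
  if n is m.+1 then [seq x :: u | x <- iota 0 k, u <- words m] else [:: [::]].

Lemma size_words n : size (words n) = k ^ n.
Proof. by elim: n => //= n IH; rewrite size_allpairs size_iota IH expnS. Qed.

Lemma words_uniq n : uniq (words n).
Proof.
elim: n => //= n IH; apply: allpairs_uniq; rewrite ?iota_uniq //.
by move=> [x u] [y v] _ _ /= [-> ->].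
Qed.

Lemma mem_words n w : word k n w -> w \in words n.
Proof.
elim: n w => [|n IH] [|x w] //; rewrite /word /= => /and3P[sz_w lt_xk w_k].
apply/allpairsP; exists (x, w); rewrite /= mem_iota add0n; split=> //.
by apply: IH; rewrite /word -eqSS sz_w.
Qed.

Lemma sum_words_add l m (F : seq nat -> nat) :
  \sum_(w <- words (l + m)) F w =
  \sum_(b <- words l) \sum_(v <- words m) F (b ++ v).
Proof.
elim: l F => [|l IH] F; first by rewrite big_seq1.
by rewrite /= !big_allpairs_dep; apply: eq_bigr => x _; rewrite IH.
Qed.

(** The letters [x] and [z] surround the word [u]. Letting [x] vary allows prefixes to be stripped;
    [z = x] recovers the chirality of [x :: u]. *)
Definition hits z n x (t : int) : nat :=
  \sum_(u <- words n) (path_turn x (rcons u z) == t).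

Section Blocks.

Variable J : nat.
Hypothesis k_gt2 : 2 < k.

Definition block j := flatten (nseq j [:: 0; 1; 2]) ++ nseq (3 * (J - j)) 0.

Lemma block_tail j : j < J ->
  exists m, block j = flatten (nseq j [:: 0; 1; 2]) ++ nseq m.+1 0.
Proof. by move=> lt_j; exists (3 * (J - j)).-1; rewrite prednK //; lia. Qed.

(** Every block begins with 0, and each 012 contributes one factor 01 but no 10, because the 2
    separates the 1 from the next 0. *)
Lemma path_turn_block x j : j < J ->
  path_turn x (block j) = (turn x 0%N + j%:Z)%R.
Proof.
case/block_tail=> m ->; elim: j x => [|j IH] x /=; last by rewrite IH /turn /=; lia.
congr (_ + _)%R; elim: m => //= m ->.
by rewrite addr0.
Qed.

(** Since [j < J] leaves some padding, all blocks end alike, and exchanging them does not disturb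
    the turn of what follows. *)
Lemma last_block x j : j < J -> last x (block j) = 0.
Proof.
by case/block_tail=> m ->; rewrite last_cat /=; elim: m => //= m; case: m.
Qed.

Lemma word_block j : j < J -> word k (3 * J) (block j).
Proof.
move=> lt_j; rewrite /word size_cat size_nseq size_flatten /shape map_nseq sumn_nseq.
apply/andP; split; first by apply/eqP => /=; lia.
rewrite all_cat all_nseq /= (ltn_trans _ k_gt2) // orbT andbT.
by elim: j {lt_j} => //= j ->; rewrite k_gt2 !andbT; apply/andP; split; lia.
Qed.

Let blocks := map block (iota 0 J).

Lemma blocks_uniq : uniq blocks.
Proof.
rewrite map_inj_in_uniq ?iota_uniq // => i j; rewrite !mem_iota !add0n => lt_i lt_j.
move=> /(congr1 (path_turn 0)); rewrite !path_turn_block //; lia.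
Qed.

Lemma filter_blocks : perm_eq [seq b <- words (3 * J) | b \in blocks] blocks.
Proof.
apply: uniq_perm; rewrite ?filter_uniq ?words_uniq ?blocks_uniq // => b.
rewrite mem_filter andb_idr // => /mapP[j]; rewrite mem_iota => lt_j ->.
exact/mem_words/word_block.
Qed.

Lemma count_not_block : count [predC blocks] (words (3 * J)) + J = k ^ (3 * J).
Proof.
rewrite -size_words -(count_predC (mem blocks)) addnC; congr (_ + _).
by rewrite -size_filter (perm_size filter_blocks) size_map size_iota.
Qed.

(* Among the words that start with one of the [J] blocks and share the
   remaining letters, at most one has a prescribed path turn. *)
Lemma hits_block_step z n B x t : (forall y s, hits z n y s <= B) ->
  hits z (3 * J + n) x t <= (k ^ (3 * J) - J) * B + k ^ n.
Proof.
move=> le_B; rewrite /hits sum_words_add (bigID (mem blocks)) /= addnC.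
apply: leq_add.
  (* After a prefix that is not a block, [B] applies with the target lowered by the turn of that
     prefix. *)
  have -> : k ^ (3 * J) - J = count [predC blocks] (words (3 * J)).
    by rewrite -count_not_block addnK.
  rewrite -sum1_count big_distrl /=; apply: leq_sum => b _.
  rewrite mul1n; apply: leq_trans (le_B (last x b) (t - path_turn x b)%R).
  apply: leq_sum => v _; rewrite rcons_cat path_turn_cat.
  by rewrite [(_ + _)%R]addrC -subr_eq opprK.
rewrite -big_filter (perm_big _ filter_blocks) /= big_map exchange_big /=.
rewrite -size_words -sum1_size; apply: leq_sum => v _.
pose P j := (turn x 0%N + j%:Z + path_turn 0 (rcons v z) == t)%R.
apply: (@leq_trans (count P (iota 0 J))); last first.
  by apply: count_le1 => [|i j]; rewrite ?iota_uniq // /P => /eqP + /eqP; lia.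
rewrite -sum1_count [leqRHS]big_mkcond big_seq [leqRHS]big_seq /=.
apply: leq_sum => j; rewrite mem_iota add0n => lt_j.
by rewrite rcons_cat path_turn_cat path_turn_block // last_block.
Qed.

(** This solves the recursion of [hits_block_step] over [m] blocks. The factor [J] clears the
    denominator of the geometric series of ratio [(K - J) / K]. *)
Lemma hits_bound z m r x t :
  J * hits z (m * (3 * J) + r) x t <=
    ((k ^ (3 * J)) ^ m + J * (k ^ (3 * J) - J) ^ m) * k ^ r.
Proof.
set K := k ^ (3 * J).
have J_le : J <= K by rewrite /K -count_not_block leq_addl.
suff [B le_B BJ] : exists2 B, forall y s, hits z (m * (3 * J) + r) y s <= B &
    J * B <= (K ^ m + J * (K - J) ^ m) * k ^ r.
  by apply: leq_trans BJ; rewrite leq_mul2l le_B orbT.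
elim: m => [|m [B le_B BJ]].
  exists (k ^ r) => [y s|]; last by rewrite !expn0 muln1 leq_mul2r leq_addl orbT.
  rewrite mul0n add0n -size_words -sum1_size; apply: leq_sum => v _.
  exact: leq_b1.
exists ((K - J) * B + k ^ (m * (3 * J) + r)) => [y s|].
  by rewrite mulSn -addnA; apply: hits_block_step.
rewrite expnD mulnC [m * _]mulnC expnM -/K.
have [d def_K] : exists d, K = d + J by exists (K - J); rewrite subnK.
move: BJ; rewrite def_K addnK !expnS; move: (_ ^ m) (d ^ m) (k ^ r) => p q c; nia.
Qed.

(** The threshold on [n] provides at least [K] aligned positions, enough for [geometric_decay] with
    [d = K - J]. *)
Lemma hits_small z n x t : 0 < J -> k ^ (3 * J) * (3 * J) <= n ->
  J * hits z n x t <= 2 * k ^ n.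
Proof.
move=> J_gt0; set K := k ^ (3 * J) => n_large.
have K_gt0 : 0 < K by rewrite expn_gt0; lia.
have J_le : J <= K by rewrite /K -count_not_block leq_addl.
have m_large : K <= n %/ (3 * J) by rewrite leq_divRL //; lia.
rewrite {1}(divn_eq n (3 * J)); apply: leq_trans (hits_bound _ _ _ _ _) _.
rewrite -/K [in leqRHS](divn_eq n (3 * J)) expnD [_ * (3 * J)]mulnC expnM -/K mulnA.
rewrite leq_mul2r mul2n -addnn leq_add2l -{2}(subnK J_le) geometric_decay ?orbT //.
  exact: leq_trans m_large.
by apply: leq_trans m_large; rewrite leq_subr.
Qed.

End Blocks.

Lemma achiral_words_small J : 2 < k -> 0 < J ->
  exists n0, forall n, n0 <= n -> J * #|achiral_words k n| <= 2 * k ^ n.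
Proof.
(* The successor accounts for the first letter [x], which is split off so that the rest is counted
   by [hits x n x 0]. *)
move=> k_gt2 J_gt0; exists (k ^ (3 * J) * (3 * J)).+1 => -[//|n].
rewrite ltnS => n_large.
apply: (@leq_trans (J * \sum_(w <- words n.+1) (chirality w == 0%R))).
  rewrite leq_mul2l; apply/orP; right; rewrite cardE -(size_map (@str k n.+1)).
  rewrite -big_mkcond sum1_count -size_filter; apply: uniq_leq_size.
    by rewrite map_inj_uniq ?enum_uniq //; exact: str_inj.
  move=> _ /mapP[t + ->]; rewrite mem_enum inE mem_filter.
  by rewrite (mem_words (word_str t)) andbT.
rewrite /= big_allpairs_dep big_distrr /=.
apply: (@leq_trans (\sum_(x <- iota 0 k) 2 * k ^ n)).
  by apply: leq_sum => x _; apply: hits_small.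
by rewrite big_const_seq count_predT size_iota iter_addn_0 expnS; lia.
Qed.

End Words.

(** * Relative closeness of [Mk] and [Lk], and the limit *)

Lemma Mk_Lk_close k J : 2 < k -> 3 < J -> exists n0, forall n, n0 <= n ->
  [/\ 0 < Lk k n, J * Mk k n <= J * Lk k n + 4 * Lk k n
                & J * Lk k n <= J * Mk k n + 4 * Lk k n].
Proof.
move=> k_gt2 J_gt3; have [|n0 small] := achiral_words_small k_gt2 (J := J).
  exact: ltn_trans J_gt3.
exists n0 => n /small le_Z.
have N_gt0 : 0 < k ^ n by rewrite expn_gt0; lia.
have M_le := Mk_le k n; have L_le := Lk_le k n; have L_ge := Lk_ge k n.
have M_ge : k ^ n <= (Mk k n).*2 + #|achiral_words k n|.
  apply: leq_trans (card_right_words k n) _.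
  by rewrite leq_add2r leq_double right_words_leq_Mk.
move: (k ^ n) (Mk k n) (Lk k n) #|_| le_Z N_gt0 M_le L_le L_ge M_ge => N M L Z.
move=> le_Z N_gt0 M_le L_le L_ge M_ge.
(* From [J * Z <= 2 * N] and [3 < J], [Z] is at most half of [N], so [2 * L] is at least the other
   half. Then [J] times the difference of [2 * M] and [2 * L] is at most [2 * N], hence at most
   [8 * L]. *)
have N_le : N <= 4 * L by nia.
by split; nia.
Qed.

(* Not imported earlier, since it takes the delimiter [%R] from [ring_scope]. *)
From Stdlib Require Import Reals Lra.

Theorem mainTheorem12 (k : nat) (hk : (3 <= k)%coq_nat) :
  Un_cv (fun n => ((INR (Mk k n) - INR (Lk k n)) / INR (Lk k n))%R) 0%R.
Proof.
move=> eps eps_gt0.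
have [|J0 [J0_large J0_gt0]] := archimed_cor1 (eps / 4); first lra.
have J0R_gt0 := lt_0_INR _ J0_gt0.
(* [J0] beats [4 / eps]; adding 4 also secures [3 < J]. *)
pose J := J0 + 4.
have J_large : (4 < eps * INR J)%R.
  rewrite /J -plusE plus_INR; apply: (Rlt_le_trans _ (eps * INR J0)); last first.
    by have := pos_INR 4; nra.
  move/(Rmult_lt_compat_r _ _ _ J0R_gt0): J0_large.
  by rewrite Rinv_l; lra.
have J_gt0 : (0 < INR J)%R by apply: lt_0_INR; rewrite /J; lia.
have [||n0 close] := @Mk_Lk_close k J; [lia|rewrite /J; lia|].
exists n0 => n /ssrnat.leP /close[/ssrnat.ltP /lt_0_INR L_gt0].
move=> /ssrnat.leP /le_INR + /ssrnat.leP /le_INR.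
rewrite -!plusE -!multE !plus_INR !mult_INR [INR 0]/=.
rewrite /Rdist Rminus_0_r; set M := INR (Mk k n); set L := INR (Lk k n).
set x := ((M - L) / L)%R => M_le L_le.
(* In terms of the relative error [x], both bounds say that [INR J * L * x] has absolute value at
   most [4 * L], which is below [INR J * L * eps]. *)
have def_M : M = (L + x * L)%R by rewrite /x; field; apply: Rgt_not_eq.
rewrite {}def_M in M_le L_le *.
have JL_gt0 : (0 < INR J * L)%R by apply: Rmult_lt_0_compat.
by apply: Rabs_def1; apply: (Rmult_lt_reg_l (INR J * L)) => //; nra.
Qed.
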